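(* For every integer $t$ there is a constant $c=c(t)$ such that for every $\epsilon>0$ there is $K=O_t((1/\epsilon)^c)$ with the following property: for every finite graph $G$ of twin-width at most $t$ there is a partition $P_1,\dots,P_K$ of $V(G)$ such that \[\sum |P_i||P_j| \le \epsilon |V(G)|^2,\] where the sum ranges over all pairs $(i,j)\in[K]^2$ such that $P_i$ and $P_j$ are not homogeneous.
   Context: Graphs are finite, undirected and simple. Two vertex sets $X,Y$ are homogeneous if either every $x\in X$ and $y\in Y$ are adjacent, or no $x\in X$ and $y\in Y$ are adjacent. $K=O_t((1/\epsilon)^c)$ means $K\le C_t(1/\epsilon)^c$ for a constant $C_t$ depending only on $t$. Twin-width: a trigraph has black and red edges; contracting $u,v$ into $w$ makes $wx$ black if $ux,vx$ are both black edges, a non-edge if both are non-edges, and red otherwise; the twin-width of $G$ is the least $d$ such that $G$ can be contracted to a single vertex with every intermediate trigraph having red degree at most $d$.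
   Formalization: The bound K ≤ C_t(1/ε)^c is replaced by K ≤ C_t·max(1,1/ε)^c: for ε ≤ 1 it is the stated bound, while for ε > 1 it is the constant C_t, since the literal bound would force K = 0 for large ε. *)

(* Defs.v *)
From HB Require Import structures.
From mathcomp Require Import all_boot all_order all_algebra.
From mathcomp Require Import boolp reals exp.

Set Implicit Arguments.
Unset Strict Implicit.
Unset Printing Implicit Defensive.

(* The vertex set is a subset of a fixed ambient type, so that all trigraphs of
   a contraction sequence live over the vertex type of the initial graph; edges
   are meaningful only between elements of [tverts]. *)
Record trigraph (T : finType) := Trigraph {
  tverts : {set T};
  black : rel T;
  red : rel T;
  black_sym : symmetric black;
  red_sym : symmetric red;
  black_irr : irreflexive black;
  red_irr : irreflexive red;
  black_red_disj : forall x y, ~~ (black x y && red x y) }.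

Section Contraction.
Variables (T : finType) (G : trigraph T) (u v : T).

Definition nonedge (x y : T) : bool := ~~ black G x y && ~~ red G x y.

(* The vertex w obtained by contracting u and v is again called u; the two
   predicates below give its edges towards the remaining vertices x. *)
Definition new_black (x : T) : bool :=
  [&& x != u, x != v, black G u x & black G v x].

Definition new_red (x : T) : bool :=
  [&& x != u, x != v, ~~ (black G u x && black G v x)
    & ~~ (nonedge u x && nonedge v x)].

Definition contract_black (x y : T) : bool :=
  if x == u then new_black y else if y == u then new_black x else black G x y.

Definition contract_red (x y : T) : bool :=
  if x == u then new_red y else if y == u then new_red x else red G x y.

Lemma contract_black_sym : symmetric contract_black.
Proof.
move=> x y; rewrite /contract_black.
by have [->|_] := eqVneq x u; have [eyu|_] := eqVneq y u; rewrite ?eyu // black_sym.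
Qed.

Lemma contract_red_sym : symmetric contract_red.
Proof.
move=> x y; rewrite /contract_red.
by have [->|_] := eqVneq x u; have [eyu|_] := eqVneq y u; rewrite ?eyu // red_sym.
Qed.

Lemma contract_black_irr : irreflexive contract_black.
Proof.
move=> x; rewrite /contract_black /new_black.
by case: (eqVneq x u) => [//|_]; exact: black_irr.
Qed.

Lemma contract_red_irr : irreflexive contract_red.
Proof.
move=> x; rewrite /contract_red /new_red.
by case: (eqVneq x u) => [//|_]; exact: red_irr.
Qed.

Lemma contract_disj x y : ~~ (contract_black x y && contract_red x y).
Proof.
have new_disj z : ~~ (new_black z && new_red z).
  by apply/negP => /andP[/and4P[_ _ a b] /and4P[_ _]]; rewrite a b.
rewrite /contract_black /contract_red.
by case: ifP => // _; case: ifP => // _; exact: black_red_disj.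
Qed.

Definition contract : trigraph T :=
  @Trigraph T (tverts G :\ v) contract_black contract_red
    contract_black_sym contract_red_sym contract_black_irr contract_red_irr
    contract_disj.

End Contraction.

Definition red_degree_le (T : finType) (d : nat) (G : trigraph T) : bool :=
  [forall x in tverts G, #|[set y in tverts G | red G x y]| <= d].

(* A sequence stops at a trigraph with at most one vertex rather than exactly
   one; this only matters for the graph without vertices, whose twin-width is
   thereby 0. *)
Inductive contractible (T : finType) (d : nat) : trigraph T -> Prop :=
| contractible_stop (G : trigraph T) :
    red_degree_le d G -> #|tverts G| <= 1 -> contractible d G
| contractible_step (G : trigraph T) (u v : T) :
    red_degree_le d G -> u \in tverts G -> v \in tverts G -> u != v ->
    contractible d (contract G u v) -> contractible d G.

Section TwinWidth.
Variables (T : finType) (e : rel T).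
Hypotheses (e_sym : symmetric e) (e_irr : irreflexive e).

Lemma no_red_sym : symmetric (fun _ _ : T => false).
Proof. by []. Qed.

Lemma no_red_irr : irreflexive (fun _ _ : T => false).
Proof. by []. Qed.

Lemma no_red_disj x y : ~~ (e x y && false).
Proof. by rewrite andbF. Qed.

Definition trigraph_of_graph : trigraph T :=
  @Trigraph T [set: T] e (fun _ _ => false)
    e_sym no_red_sym e_irr no_red_irr no_red_disj.

Lemma contractible_card (G : trigraph T) : contractible #|T| G.
Proof.
have red_le H : red_degree_le #|T| (H : trigraph T).
  by apply/forall_inP => x _; exact: max_card.
have [n] := ubnP #|tverts G|; elim: n G => // n IHn G ltGn.
have [le1|/card_gt1P[u [v [uG vG neq]]]] := leqP #|tverts G| 1.
  exact: contractible_stop.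
apply: (contractible_step (red_le G) uG vG neq); apply: IHn.
by move: ltGn; rewrite (cardsD1 v) vG.
Qed.

Lemma twin_width_ex : exists d, `[< contractible d trigraph_of_graph >].
Proof. by exists #|T|; apply/asboolP; exact: contractible_card. Qed.

Definition twin_width : nat := ex_minn twin_width_ex.

End TwinWidth.

Definition homogeneous (T : finType) (e : rel T) (X Y : {set T}) : bool :=
  [forall x in X, forall y in Y, e x y] ||
  [forall x in X, forall y in Y, ~~ e x y].

(* Parts may be empty: the number K of parts is chosen before the graph. *)
Definition is_partition (T : finType) (K : nat) (P : 'I_K -> {set T}) : Prop :=
  (forall i j : 'I_K, i != j -> [disjoint P i & P j]) /\
  \bigcup_(i < K) P i = [set: T].

(* The bound C (1/eps)^c expressed by "K = O_t((1/eps)^c)" concerns eps <= 1,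
   where the maximum is 1/eps. For eps > 1 it would tend to 0 and exclude even
   K = 1, so it is replaced there by the constant C. *)
Definition poly_bound (R : realType) (C c eps : R) : R :=
  (C * (Num.max 1 (eps^-1)) `^ c)%R.

(* Main.v *)
Require Import Defs.
From mathcomp Require Import all_boot all_order all_algebra.
From mathcomp Require Import boolp reals exp.
From mathcomp Require Import zify.

(* Follow a contraction sequence of width d. Every part keeps a set of pending
   vertices; when the pending set of a freshly merged part reaches n/N vertices
   it is closed, i.e. becomes a block. This gives at most N+1 blocks, each of at
   most 2n/N vertices. When X is closed inside a part A, every part which is not
   a red neighbour of A sees X uniformly, and the pending vertices of each red
   neighbour end up in one block; so apart from at most d blocks, every vertex of
   a later block Y is adjacent to all or to none of X. Hence the pairs (X, Y) not
   uniform in this sense carry weight O(d n^2/N). Finally split the blocks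
   according to the trace of the neighbourhoods on a set of representatives of
   the blocks, which makes the uniform pairs homogeneous; there are only O_d(N)
   traces since, when two elements of a set S are merged for the first time,
   only the vertices in d+1 parts separate them, and these have at most
   (d+1) 2^(d+2) traces on S. *)

Set Implicit Arguments.
Unset Strict Implicit.
Unset Printing Implicit Defensive.

Import Order.TTheory GRing.Theory Num.Theory.
Local Open Scope ring_scope.

(** * Contraction steps as quotients of the initial graph *)

Section Representation.
Local Open Scope nat_scope.
Variables (T : finType) (e : rel T).
Hypothesis e_sym : symmetric e.

(* [b] sends each vertex of the graph to the name of its part in the trigraph. *)
Definition represents (H : trigraph T) (b : T -> T) : Prop :=
  (forall x, b x \in tverts H) /\
  (forall x y, b x != b y -> ~~ red H (b x) (b y) -> e x y = black H (b x) (b y)).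

Definition merge_to (u v : T) (b : T -> T) (x : T) : T :=
  if b x == v then u else b x.

(** A non-red edge at the merged vertex arises only from two black edges or two non-edges, so both
    halves of the merged part already had the same adjacency to the other part. *)
Lemma represents_contract H b u v :
  u \in tverts H -> u != v -> represents H b ->
  represents (contract H u v) (merge_to u v b).
Proof.
move=> uH neq [bH bE]; split=> [x|].
  rewrite /merge_to; case: (eqVneq (b x) v) => [_|nv] /=.
    by rewrite !inE neq uH.
  by rewrite !inE nv bH.
have new x y : merge_to u v b x = u -> b y != u -> b y != v ->
    ~~ new_red H u v (b y) -> e x y = new_black H u v (b y).
  rewrite /new_red /new_black => xu yu yv; rewrite yu yv /= => nr.
  have xuv : b x = u \/ b x = v.
    by move: xu; rewrite /merge_to; case: eqP; [right|left].
  have dis w : black H w (b y) -> ~~ red H w (b y).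
    by move=> bw; move: (black_red_disj H w (b y)); rewrite bw.
  case bb: (black H u (b y) && black H v (b y)); move: bb nr => /=.
    case/andP=> bu bv _.
    by case: xuv => E; rewrite bE E 1?eq_sym // dis.
  move=> bb; rewrite bb negbK => /andP[/andP[bu ru] /andP[bv rv]].
  case: xuv => E; rewrite bE E 1?eq_sym //; exact: negbTE.
move=> x y; set x' := merge_to u v b x; set y' := merge_to u v b y.
move=> nxy; rewrite /= /contract_red /contract_black.
have unmerged z : merge_to u v b z != u ->
    [/\ merge_to u v b z = b z, b z != u & b z != v].
  by rewrite /merge_to; case: (eqVneq (b z) v) => [_|]; rewrite ?eqxx.
have [xu|xu] := eqVneq x' u.
  have yu : y' != u by rewrite -xu eq_sym.
  by have [Ey yu' yv] := unmerged y yu; rewrite /y' Ey; apply: new.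
have [Ex xu' xv] := unmerged x xu.
have [yu|yu] := eqVneq y' u.
  by rewrite /x' Ex e_sym => ?; apply: new.
have [Ey yu' yv] := unmerged y yu.
by move: nxy; rewrite /x' /y' Ex Ey; apply: bE.
Qed.

Lemma represents_distinguish H b x1 x2 y :
  represents H b -> b x1 = b x2 -> e x1 y != e x2 y ->
  b y != b x1 -> red H (b x1) (b y).
Proof.
move=> [_ bE] E12 + ny; apply: contraNT => nr.
by rewrite !bE -?E12 // eq_sym.
Qed.

Lemma contractible_red_degree d (H : trigraph T) :
  contractible d H -> red_degree_le d H.
Proof. by case. Qed.

Lemma card_bigcup_le (I J : finType) (A : {set I}) (F : I -> {set J}) :
  #|\bigcup_(i in A) F i| <= \sum_(i in A) #|F i|.
Proof.
elim/big_rec2: _ => [|i m X _ le]; first by rewrite cards0.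
by apply: leq_trans (leq_card_setU _ _) _; rewrite leq_add2l.
Qed.

(** * Number of neighbourhood traces on a set *)

Definition trace (S : {set T}) (y : T) : {set T} := [set s in S | e s y].

Definition traces (S : {set T}) : {set {set T}} := [set trace S y | y in T].

Definition nbhd_bound (d : nat) : nat := d.+1 * 2 ^ d.+2.

Definition red_closed_nbhd (H : trigraph T) (u : T) : {set T} :=
  u |: [set y in tverts H | red H u y].

Lemma card_red_closed_nbhd d H u :
  red_degree_le d H -> u \in tverts H -> #|red_closed_nbhd H u| <= d.+1.
Proof.
move=> /forall_inP/(_ u) deg /deg le_d.
rewrite /red_closed_nbhd cardsU1 -add1n; apply: leq_add => //.
exact: leq_b1.
Qed.

(** If the part of [s] is outside the closed red neighbourhood of [q], all vertices of part [q]
    agree on [s]. So their traces differ only within [M], which has at most one element for each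
    part of that neighbourhood, plus possibly [s2]. *)
Lemma card_traces_part d H b (S : {set T}) s2 q :
  represents H b -> red_degree_le d H -> q \in tverts H ->
  {in S :\ s2 &, injective b} ->
  #|[set trace S y | y in [set y | b y == q]]| <= 2 ^ d.+2.
Proof.
move=> rep deg qH inj.
have [bH bE] := rep.
set M := [set s in S | b s \in red_closed_nbhd H q].
set F := [set s in S | (b s \notin red_closed_nbhd H q) && black H (b s) q].
have leM : #|M| <= d.+2.
  rewrite (cardsD1 s2 M) -add1n; apply: leq_add; first exact: leq_b1.
  rewrite -(@card_in_imset _ _ b).
    apply: leq_trans (card_red_closed_nbhd deg qH); apply: subset_leq_card.
    by apply/subsetP=> _ /imsetP[s /setD1P[_ /setIdP[_ ?]] ->].
  by move=> s s' /setD1P[n1 /setIdP[S1 _]] /setD1P[n2 /setIdP[S2 _]]; apply: inj;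
    rewrite !inE ?n1 ?n2.
apply: (@leq_trans #|[set F :|: Z | Z in powerset M]|); last first.
  by apply: leq_trans (leq_imset_card _ _) _; rewrite card_powerset leq_exp2l.
apply: subset_leq_card; apply/subsetP=> Z /imsetP[y /[1!inE] /eqP yq ->{Z}].
apply/imsetP; exists (trace S y :&: M); first by rewrite inE subsetIr.
apply/setP=> s; rewrite !inE; case: (s \in S) => //=.
case near: ((b s == q) || _) => /=; rewrite ?andbT ?andbF ?orbF //.
move/negbT: near; rewrite ?negb_or bH /= => /andP[nq nr].
by rewrite bE yq // red_sym.
Qed.

(** Take the first contraction that puts two elements of [S] into one part: a vertex separating them
    lies in the new part or in a red neighbour of it. *)
Lemma similar_pair d H b (S : {set T}) :
  contractible d H -> represents H b -> 1 < #|S| -> {in S &, injective b} ->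
  exists s1 s2, [/\ s1 \in S, s2 \in S, s1 != s2 &
    #|[set trace S y | y in [set y | e s1 y != e s2 y]]| <= nbhd_bound d].
Proof.
move=> con; elim: con b => [{}H _ le1|{}H u v degH uH vH neq con IH] b rep gt1 inj.
  have: #|b @: S| <= #|tverts H|.
    by apply: subset_leq_card; apply/subsetP=> _ /imsetP[x _ ->]; case: rep.
  by rewrite card_in_imset // leqNgt (leq_ltn_trans le1 gt1).
have rep' := represents_contract uH neq rep.
set G' := contract H u v in con IH rep'; set b' := merge_to u v b in rep'.
have deg' := contractible_red_degree con.
case: (boolP [exists s1 in S, exists s2 in S, (s1 != s2) && (b' s1 == b' s2)]);
    last first.
  move=> noc; apply: (IH b' rep' gt1) => s1 s2 S1 S2 E; apply/eqP.
  apply: contraNT noc => n12; apply/exists_inP; exists s1 => //.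
  by apply/exists_inP; exists s2; rewrite // n12 E eqxx.
case/exists_inP=> s1 S1 /exists_inP[s2 S2 /andP[n12 /eqP E12]].
exists s1, s2; split=> //.
have merged s s' : s \in S -> s' \in S -> s != s' -> b' s = b' s' ->
    (b s = u /\ b s' = v) \/ (b s = v /\ b s' = u).
  move=> Ss Ss' nss; rewrite /b' /merge_to.
  have nb : b s != b s' by apply: contra nss => /eqP/inj->.
  move: nb; have [->|nv] := eqVneq (b s) v; have [->|nv'] := eqVneq (b s') v.
  - by [].
  - by move=> _ <-; right.
  - by move=> _ ->; left.
  - by move=> /eqP ? ?.
(* Each of [u] and [v] holds at most one element of [S], so [s1], [s2] is the only pair of [S]
   merged here. *)
have inj' : {in S :\ s2 &, injective b'}.
  move=> a a' /setD1P[na Sa] /setD1P[na' Sa'] Eaa'; apply/eqP/negPn/negP => naa'.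
  have s2uv := merged _ _ S1 S2 n12 E12.
  have aa'uv := merged _ _ Sa Sa' naa' Eaa'.
  have ab : b s2 = b a \/ b s2 = b a'.
    by case: s2uv => -[_ ->]; case: aa'uv => -[-> ->]; [right|left|left|right].
  by case: ab => /inj E; [move: na|move: na']; rewrite -E // eqxx.
set Q := red_closed_nbhd G' (b' s1).
apply: (@leq_trans #|\bigcup_(q in Q) [set trace S y | y in [set y | b' y == q]]|).
  apply: subset_leq_card; apply/subsetP=> Z /imsetP[y /[1!inE] dy ->{Z}].
  apply/bigcupP; exists (b' y); last by apply: imset_f; rewrite inE.
  rewrite in_setU1 in_set; have [//|ny] := eqVneq (b' y) (b' s1).
  have [b'G _] := rep'.
  by rewrite (represents_distinguish rep' E12 dy ny) andbT b'G.
have QG q : q \in Q -> q \in tverts G'.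
  by have [b'G _] := rep'; rewrite /Q /red_closed_nbhd in_setU1 => /orP[/eqP->//|/setIdP[]].
apply: (@leq_trans (\sum_(q in Q) 2 ^ d.+2)).
  apply: leq_trans (card_bigcup_le _ _) _.
  apply: leq_sum => q Qq; exact: (card_traces_part rep' deg' (QG q Qq) inj').
rewrite sum_nat_const leq_mul2r card_red_closed_nbhd ?orbT //.
by have [b'G _] := rep'.
Qed.

Lemma represents_id (e_irr : irreflexive e) :
  represents (trigraph_of_graph e_sym e_irr) id.
Proof. by split=> // x; rewrite inE. Qed.

(* Traces not separating a pair s1, s2 of S as in [similar_pair] are determined
   by their restriction to S :\ s2. *)
Lemma card_traces d (e_irr : irreflexive e) (S : {set T}) :
  contractible d (trigraph_of_graph e_sym e_irr) ->
  #|traces S| <= #|S| * nbhd_bound d + 2.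
Proof.
move=> con; have [n] := ubnP #|S|; elim: n S => // n IH S ltSn.
have [le1|gt1] := leqP #|S| 1.
  (* Origin of the summand 2: a set with at most one element has at most two subsets. *)
  apply: (@leq_trans #|powerset S|).
    apply: subset_leq_card; apply/subsetP=> _ /imsetP[y _ ->].
    by rewrite inE; apply/subsetP=> s /setIdP[].
  rewrite card_powerset; apply: (@leq_trans 2); last exact: leq_addl.
  by rewrite -[leqRHS]expn1 leq_exp2l.
have [s1 [s2 [S1 S2 n12 le]]] :=
  similar_pair con (represents_id e_irr) gt1 (in2W (@inj_id T)).
have cS := cardsD1 s2 S; rewrite S2 add1n in cS.
rewrite cS mulSn -addnA; apply: leq_trans (leq_add le (IH (S :\ s2) _)); last first.
  by rewrite -ltnS -cS.
set A := [set trace S y | y in [set y | e s1 y != e s2 y]].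
set B := [set trace S y | y in [set y | e s1 y == e s2 y]].
apply: (@leq_trans #|A :|: B|).
  apply: subset_leq_card; apply/subsetP=> _ /imsetP[y _ ->].
  rewrite inE; case: (boolP (e s1 y == e s2 y)) => E; apply/orP; [right|left];
    by apply: imset_f; rewrite inE.
apply: leq_trans (leq_card_setU A B) _; rewrite leq_add2l.
have -> : #|B| = #|[set Z :\ s2 | Z in B]|.
  rewrite card_in_imset // => _ _ /imsetP[y + ->] /imsetP[y' + ->].
  rewrite !inE => /eqP E /eqP E' /setP EZ; apply/setP=> s.
  have [->|ns] := eqVneq s s2; last by have := EZ s; rewrite !inE ns.
  by have := EZ s1; rewrite !inE n12 S1 S2 /= E E'.
apply: subset_leq_card; apply/subsetP=> _ /imsetP[_ /imsetP[y _ ->] ->].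
apply/imsetP; exists y => //; apply/setP=> s; rewrite !inE.
by rewrite andbA.
Qed.

(** * Closing blocks along the contraction sequence *)

Definition block (f : T -> T) (U : {set T}) (x : T) : {set T} :=
  [set z in U | f z == f x].

Definition steady (X : {set T}) (y : T) : bool :=
  [forall x1 in X, forall x2 in X, e x1 y == e x2 y].

(** Weaker than homogeneity: under the first alternative, one [y] may see all of [X] and another one
    nothing of it. The disjunction is there because a labelling does not record which of two blocks
    was closed first. *)
Definition good_pair (X Y : {set T}) : bool :=
  [forall y in Y, steady X y] || [forall x in X, steady Y x].

Lemma good_pairC X Y : good_pair X Y = good_pair Y X.
Proof. by rewrite /good_pair orbC. Qed.

(** Pairs of vertices rather than of blocks: the cardinality is then the sum of |X||Y| over the bad
    pairs of blocks. *)
Definition bad_pairs (f : T -> T) (U : {set T}) : {set T * T} :=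
  [set p in setX U U | ~~ good_pair (block f U p.1) (block f U p.2)].

(* [f] maps each vertex of U to a representative of its block; [label_coarse]
   says that the pending vertices of a part are never separated. *)
Record block_labelling (d n N : nat) (b : T -> T) (U : {set T})
    (f : T -> T) : Prop := {
  label_in : {in U, forall x, f x \in U};
  label_idem : {in U, forall x, f (f x) = f x};
  label_coarse : {in U &, forall x y, b x = b y -> f x = f y};
  label_count : #|f @: U| * n <= N * #|U| + n;
  label_size : {in U, forall x, N * #|block f U x| <= 2 * n};
  label_bad : N * #|bad_pairs f U| <= 4 * d.+1 * n * #|U| }.

(** [U] collects the vertices not yet in a closed block. The threshold n/N is multiplied out, as in
    [block_labelling], to stay in [nat]. *)
Definition pending_le (n N : nat) (b : T -> T) (U : {set T}) : Prop :=
  forall q, N * #|[set x in U | b x == q]| <= n.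

(** End of the sequence: what is still pending forms one last block, possibly smaller than n/N. It
    accounts for the summand [n] in [label_count]. *)
Lemma block_labelling_single d n N b U (H : trigraph T) :
  represents H b -> #|tverts H| <= 1 -> pending_le n N b U ->
  exists f, block_labelling d n N b U f.
Proof.
move=> [bH _] le1 pend.
have [->|[r rU]] := set_0Vmem U.
  exists id; split; try by [move=> x; rewrite inE | move=> x y; rewrite inE].
    by rewrite imset0 cards0.
  suff -> : bad_pairs id set0 = set0 by rewrite cards0 muln0.
  by apply/setP=> -[x y]; rewrite !inE.
have ub x : b x = b r by move/card_le1_eqP: le1; apply; apply: bH.
have leU : N * #|U| <= n.
  have := pend (b r); suff -> : [set x in U | b x == b r] = U by [].
  by apply/setP=> x; rewrite inE ub eqxx andbT.
exists (fun=> r); split=> //.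
- have -> : [set r | _ in U] = [set r].
    apply/setP=> x; rewrite inE; apply/imsetP/eqP => [[]//|->]; by exists r.
  by rewrite cards1 mul1n leq_addl.
- move=> x xU; have -> : block (fun=> r) U x = U.
    by apply/setP=> z; rewrite inE eqxx andbT.
  lia.
- have: #|bad_pairs (fun=> r) U| <= #|U| * #|U|.
    rewrite -cardsX; apply: subset_leq_card; apply/subsetP=> p; by case/setIdP.
  nia.
Qed.

(** Labellings are built backwards from the end of the sequence; one that respects the larger parts
    of a later step also respects the smaller ones before it. *)
Lemma block_labelling_refine d n N b b' U f :
  (forall x y, b x = b y -> b' x = b' y) ->
  block_labelling d n N b' U f -> block_labelling d n N b U f.
Proof. by move=> bb' [? ? co ? ? ?]; split=> // x y xU yU /bb'; apply: co. Qed.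

(* Only the blocks meeting a red neighbour of the part containing X can form a
   bad pair with X, and each part meets a single block. *)
Lemma card_bad_blocks d n N (H : trigraph T) b u (X V : {set T}) f :
  represents H b -> red_degree_le d H -> u \in tverts H ->
  {in X, forall x, b x = u} -> {in V, forall y, b y != u} ->
  block_labelling d n N b V f ->
  N * #|[set y in V | ~~ good_pair X (block f V y)]| <= 2 * d * n.
Proof.
move=> rep deg uH bX bV lab.
have [bH _] := rep.
set Q := [set q in tverts H | red H u q].
set W := fun q => [set y in V | [exists z in block f V y, b z == q]].
have leQ : #|Q| <= d by move/forall_inP: deg; apply.
have leW q : N * #|W q| <= 2 * n.
  have [->|[y /setIdP[yV /exists_inP[z /setIdP[zV /eqP fzy] /eqP bzq]]]] := set_0Vmem (W q).
    by rewrite cards0 muln0.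
  apply: leq_trans (label_size lab yV); rewrite leq_mul2l; apply/orP; right.
  apply: subset_leq_card; apply/subsetP=> y'.
  case/setIdP=> y'V /exists_inP[z' /setIdP[z'V /eqP fzy'] /eqP bzq'].
  rewrite inE y'V -fzy -fzy' /=; apply/eqP; apply: (label_coarse lab) => //.
  by rewrite bzq.
have sub : [set y in V | ~~ good_pair X (block f V y)] \subset \bigcup_(q in Q) W q.
  apply/subsetP=> y /setIdP[yV]; rewrite negb_or => /andP[/forall_inPn[z zy nst] _].
  have zV : z \in V by case/setIdP: zy.
  move: nst => /forall_inPn[x1 X1 /forall_inPn[x2 X2 dz]].
  apply/bigcupP; exists (b z); last by rewrite inE yV; apply/exists_inP; exists z.
  have E12 : b x1 = b x2 by rewrite !bX.
  have := represents_distinguish rep E12 dz; rewrite (bX x1) // => /(_ (bV z zV)) red_z.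
  by rewrite inE bH.
apply: leq_trans (leq_mul (leqnn N) (subset_leq_card sub)) _.
apply: leq_trans (leq_mul (leqnn N) (card_bigcup_le _ _)) _.
rewrite big_distrr /=; apply: (@leq_trans (\sum_(q in Q) 2 * n)); first exact: leq_sum.
by rewrite sum_nat_const; nia.
Qed.

Lemma block_labelling_close d n N (H : trigraph T) b u (U : {set T}) f :
  let X := [set x in U | b x == u] in
  represents H b -> red_degree_le d H -> u \in tverts H ->
  0 < n -> n <= N * #|X| <= 2 * n ->
  block_labelling d n N b (U :\: X) f ->
  exists g, block_labelling d n N b U g.
Proof.
move=> X rep deg uH n0 /andP[geX leX] lab.
set V := U :\: X in lab.
have [X0|[r rX]] := set_0Vmem X; first by move: geX; rewrite X0 cards0; lia.
have XU x : x \in X -> x \in U by case/setIdP.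
have VU x : x \in V -> x \in U by case/setDP.
have VX x : x \in V -> (x \in X) = false by case/setDP=> _ /negbTE.
have UXV x : x \in U -> x \in X \/ x \in V.
  by move=> xU; case xX: (x \in X); [left | right; rewrite in_setD xX].
have fVr x : x \in V -> f x != r.
  move=> /(label_in lab) fV; apply/eqP => E.
  by move: rX; rewrite -E VX.
set g := fun x => if x \in X then r else f x.
have gX x : x \in X -> g x = r by rewrite /g => ->.
have gV x : x \in V -> g x = f x by move/VX=> xX; rewrite /g xX.
have blockX x : x \in X -> block g U x = X.
  move=> xX; apply/setP=> z; rewrite inE (gX x) //; apply/andP/idP => [[zU]|zX].
    by case: (UXV z zU) => // zV; rewrite gV // (negbTE (fVr z zV)).
  by rewrite XU // gX.
have blockV x : x \in V -> block g U x = block f V x.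
  move=> xV; apply/setP=> z; rewrite [LHS]inE [RHS]inE (gV x) //.
  apply/andP/andP => [[zU]|[zV E]]; last by rewrite VU // gV.
  case: (UXV z zU) => [zX|zV]; last by rewrite gV.
  by rewrite gX // eq_sym (negbTE (fVr x xV)).
have cU : #|U| = #|X| + #|V|.
  rewrite -(cardsID X U); congr (#|pred_of_set _| + _); apply/setIidPr/subsetP.
  exact: XU.
set Y := [set y in V | ~~ good_pair X (block f V y)].
have leY : N * #|Y| <= 2 * d * n.
  apply: (card_bad_blocks rep deg uH _ _ lab) => [x /setIdP[_ /eqP]//|y].
  by case/setDP=> yU; rewrite inE yU.
exists g; split.
- move=> x /UXV[xX|xV]; first by rewrite gX ?XU.
  by rewrite gV // VU // (label_in lab).
- move=> x /UXV[xX|xV]; first by rewrite (gX x) // gX.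
  by rewrite (gV x) // gV ?(label_in lab) // (label_idem lab).
- move=> x y xU yU E.
  have EX : (x \in X) = (y \in X) by rewrite !inE xU yU E.
  rewrite /g -EX; case xX: (x \in X) => //.
  by apply: (label_coarse lab) => //; rewrite inE ?xU ?yU ?andbT -?EX xX.
(* The new block has at least n/N vertices, so it pays for itself in [N * #|U|]. *)
- have : #|g @: U| <= #|r |: f @: V|.
    apply: subset_leq_card; apply/subsetP=> _ /imsetP[x /UXV[xX|xV] ->].
      by rewrite gX // setU11.
    by rewrite gV // in_setU1 imset_f // orbT.
  rewrite cardsU1; have := label_count lab; have := leq_b1 (r \notin f @: V).
  rewrite cU; nia.
- move=> x /UXV[xX|xV]; first by rewrite blockX.
  by rewrite blockV // (label_size lab).
(* Pairs within [V] keep their blocks, and the pair of [X] with itself is simply counted as bad. *)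
have sub : bad_pairs g U \subset
    bad_pairs f V :|: (setX X (X :|: Y) :|: setX (X :|: Y) X).
  have inY y : (y \in Y) = (y \in V) && ~~ good_pair X (block f V y) by rewrite inE.
  have inB x y : ((x, y) \in bad_pairs f V) =
    [&& x \in V, y \in V & ~~ good_pair (block f V x) (block f V y)].
    by rewrite inE in_setX andbA.
  apply/subsetP=> -[x y] /setIdP[/setXP[/= xU yU]].
  rewrite !(in_setU, in_setX) !inY inB.
  case: (UXV x xU) (UXV y yU) => [xX|xV] [yX|yV].
  - by rewrite xX yX orbT.
  - by rewrite (blockX x) // (blockV y) // => bad; rewrite xX yV bad !orbT.
  - rewrite (blockV x) // (blockX y) // good_pairC => bad.
    by rewrite yX xV bad !orbT.
  - by rewrite !blockV // => bad; rewrite xV yV bad.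
have leB : #|bad_pairs g U| <= #|bad_pairs f V| + 2 * (#|X| * (#|X| + #|Y|)).
  apply: leq_trans (subset_leq_card sub) _.
  apply: leq_trans (leq_card_setU _ _) _; rewrite leq_add2l.
  apply: leq_trans (leq_card_setU _ _) _; rewrite !cardsX.
  have : #|X :|: Y| <= #|X| + #|Y| by exact: leq_card_setU.
  nia.
(* Each vertex of [X] is charged 4(d+1)n: 2n for [X] and 2dn for [Y], doubled because pairs are
   ordered. *)
have le1 : N * (#|X| + #|Y|) <= 2 * d.+1 * n by lia.
have le2 : #|X| * (N * (#|X| + #|Y|)) <= #|X| * (2 * d.+1 * n) by rewrite leq_mul2l le1 orbT.
have lebad := label_bad lab.
apply: (leq_trans (leq_mul (leqnn N) leB)).
by rewrite cU; lia.
Qed.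

(** Induction along the sequence, for all [U]: a closed block leaves [U], and the induction
    hypothesis labels what remains. *)
Lemma block_labelling_exists d n N (H : trigraph T) b (U : {set T}) :
  0 < n -> contractible d H -> represents H b -> pending_le n N b U ->
  exists f, block_labelling d n N b U f.
Proof.
move=> n0 con; elim: con b U => [{}H _ le1|{}H u v degH uH vH neq con IH] b U rep pend.
  exact: block_labelling_single rep le1 pend.
have rep' := represents_contract uH neq rep.
have deg' := contractible_red_degree con.
set G' := contract H u v in con IH rep' deg'.
set b' := merge_to u v b in rep'.
have bb' x y : b x = b y -> b' x = b' y by rewrite /b' /merge_to => ->.
have uG' : u \in tverts G' by rewrite !inE neq.
suff [f lab] : exists f, block_labelling d n N b' U f.
  by exists f; exact: block_labelling_refine lab.
set X := [set x in U | b' x == u].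
have pend' q : q != u -> N * #|[set x in U | b' x == q]| <= n.
  move=> qu; apply: leq_trans (pend q); rewrite leq_mul2l; apply/orP; right.
  apply: subset_leq_card; apply/subsetP=> x /setIdP[xU /eqP bq].
  rewrite inE xU /=; move: bq qu; rewrite /b' /merge_to.
  by case: eqP => [_ <-|_ <-]; rewrite eqxx.
(* Both merged parts had at most n/N pending vertices; this is the factor 2 in [label_size]. *)
have leX : N * #|X| <= 2 * n.
  have: #|X| <= #|[set x in U | b x == u]| + #|[set x in U | b x == v]|.
    apply: leq_trans (leq_card_setU _ _); apply: subset_leq_card.
    apply/subsetP=> x /setIdP[xU]; rewrite !inE xU /b' /merge_to.
    by case: (eqVneq (b x) v) => [_ _|_ ->]; rewrite ?orbT.
  have := pend u; have := pend v; nia.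
have [leXn|/ltnW geX] := leqP (N * #|X|) n.
  by apply: IH => // q; have [->//|] := eqVneq q u; apply: pend'.
have [f lab] : exists f, block_labelling d n N b' (U :\: X) f.
  apply: IH => // q; have [->|qu] := eqVneq q u.
    suff -> : [set x in U :\: X | b' x == u] = set0 by rewrite cards0 muln0.
    by apply/setP=> x; rewrite !inE; case: (b' x == u); case: (x \in U).
  apply: leq_trans (pend' q qu); rewrite leq_mul2l; apply/orP; right.
  apply: subset_leq_card; apply/subsetP=> x /setIdP[/setDP[xU _] bq].
  by rewrite inE xU.
by apply: block_labelling_close rep' deg' uG' n0 _ lab; rewrite geX leX.
Qed.

Lemma coarse_labelling d N (e_irr : irreflexive e) :
  contractible d (trigraph_of_graph e_sym e_irr) -> 0 < N ->
  exists f : T -> T, [/\ forall x, f (f x) = f x, #|f @: T| <= N.+1 &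
    N * #|bad_pairs f setT| <= 4 * d.+1 * #|T| ^ 2].
Proof.
(* Initially each part is one vertex, so [pending_le] with n = [#|T|] requires N <= n. For smaller
   graphs the singletons serve as blocks, and all their pairs are good. *)
move=> con N0; have [leTN|ltNT] := leqP #|T| N.
  exists id; split=> //.
    apply: leq_trans (leq_imset_card _ _) _.
    by rewrite (leq_trans (max_card _)) // ltnW.
  suff -> : bad_pairs id setT = set0 by rewrite cards0 muln0.
  apply/setP=> -[x y]; rewrite !inE /=; apply/negbTE; rewrite negbK.
  apply/orP; left; apply/forall_inP=> z _; apply/forall_inP=> x1.
  by case/setIdP=> _ /eqP->; apply/forall_inP=> x2 /setIdP[_ /eqP->].
have T0 : 0 < #|T| by lia.
have pend : pending_le #|T| N id [set: T].
  move=> q; suff -> : [set x in setT | id x == q] = [set q] by rewrite cards1; lia.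
  by apply/setP=> x; rewrite !inE.
have [f lab] := block_labelling_exists T0 con (represents_id e_irr) pend.
exists f; split.
- by move=> x; apply: (label_idem lab); rewrite inE.
- have := label_count lab; rewrite cardsT => le.
  have -> : #|f @: T| = #|f @: [set: T]|.
    by apply: eq_card => z; apply/imsetP/imsetP => -[x _ ->]; exists x.
  by rewrite -(leq_pmul2r T0); lia.
- by have := label_bad lab; rewrite cardsT; lia.
Qed.

(** * Refinement by traces into homogeneous parts *)

Definition refined_label (f : T -> T) (x : T) : T * {set T} :=
  (f x, trace (f @: T) x).

Lemma card_refined_labels d N (e_irr : irreflexive e) f :
  contractible d (trigraph_of_graph e_sym e_irr) -> #|f @: T| <= N ->
  #|refined_label f @: T| <= N * (N * nbhd_bound d + 2).
Proof.
move=> con leN.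
apply: (@leq_trans #|setX (f @: T) (traces (f @: T))|).
  apply: subset_leq_card; apply/subsetP=> _ /imsetP[x _ ->].
  by rewrite in_setX !imset_f.
rewrite cardsX; apply: leq_mul => //.
by apply: leq_trans (card_traces _ con) _; rewrite leq_add2r leq_mul2r leN orbT.
Qed.

(* If every y in Y sees X uniformly, the trace of y at the representative of X
   decides which way, and it is constant on a refined block. *)
Lemma good_pair_homogeneous f x y :
  (forall z, f (f z) = f z) ->
  good_pair (block f setT x) (block f setT y) ->
  homogeneous e [set z | refined_label f z == refined_label f x]
                [set z | refined_label f z == refined_label f y].
Proof.
move=> ff.
(* Steadiness moves [z] to the representative [f x']; equality of traces then moves [w] to [y']. *)
have uniform x' y' z w : (forall z', z' \in block f setT y' -> steady (block f setT x') z') ->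
    refined_label f z = refined_label f x' -> refined_label f w = refined_label f y' ->
    e z w = e (f x') y'.
  move=> st [fz _] [fw tw].
  have wB : w \in block f setT y' by rewrite !inE fw eqxx.
  have /forall_inP/(_ z) := st w wB.
  rewrite !inE fz eqxx => /(_ isT)/forall_inP/(_ (f x')).
  rewrite !inE ff eqxx => /(_ isT)/eqP ->.
  by move/setP/(_ (f x')): tw; rewrite !inE imset_f.
have decide (X Y : {set T}) c : (forall z w, z \in X -> w \in Y -> e z w = c) -> homogeneous e X Y.
  by case: c => E; apply/orP; [left|right]; apply/forall_inP=> z zX;
    apply/forall_inP=> w wY; rewrite E.
case/orP=> /forall_inP st.
  by apply: (decide _ _ (e (f x) y)) => z w /[!inE] /eqP Ez /eqP Ew; apply: uniform.
apply: (decide _ _ (e (f y) x)) => z w /[!inE] /eqP Ez /eqP Ew.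
by rewrite e_sym; apply: uniform.
Qed.

(** The parts are the fibres of [g], numbered by their place in an enumeration of its values;
    surplus indices get empty parts, which add nothing to the sum. *)
Lemma labelled_partition (L : finType) (g : T -> L) (K : nat) :
  #|g @: T| <= K ->
  exists P : 'I_K -> {set T}, is_partition P /\
    \sum_(ij : 'I_K * 'I_K | ~~ homogeneous e (P ij.1) (P ij.2)) #|P ij.1| * #|P ij.2| =
    #|[set p : T * T | ~~ homogeneous e [set z | g z == g p.1] [set z | g z == g p.2]]|.
Proof.
move=> leK.
have idx x : index (g x) (enum (g @: T)) < K.
  by apply: leq_trans leK; rewrite cardE index_mem mem_enum imset_f.
set h := fun x => Ordinal (idx x).
have hE x y : (h x == h y) = (g x == g y).
  apply/eqP/eqP => [/(congr1 val)/= E|E]; last by apply/val_inj; rewrite /= E.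
  by apply: (index_inj (g x) _ _ E); rewrite mem_enum imset_f.
exists (fun i => [set x | h x == i]); split; first split.
- move=> i j nij; rewrite -setI_eq0; apply/eqP/setP=> x; rewrite !inE.
  by apply/negP=> /andP[/eqP-> /eqP E]; rewrite E eqxx in nij.
- by apply/setP=> x; rewrite in_setT; apply/bigcupP; exists (h x); rewrite // inE.
rewrite -sum1_card (partition_big (fun p => (h p.1, h p.2))
   (fun ij => ~~ homogeneous e [set x | h x == ij.1] [set x | h x == ij.2])) /=; last first.
  move=> -[x y]; rewrite inE /=; congr (~~ homogeneous _ _ _);
  by apply/setP=> z; rewrite !inE hE.
apply: eq_bigr => -[i j] /= bad; rewrite -cardsX -sum1_card; apply: eq_bigl => -[x y].
rewrite in_setX !inE xpair_eqE /=.
case: (eqVneq (h x) i) => [Ei|]; last by rewrite !andbF.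
case: (eqVneq (h y) j) => [Ej|]; last by rewrite !andbF.
rewrite !andbT; apply/esym; rewrite -[RHS]bad -Ei -Ej; congr (~~ homogeneous _ _ _);
  by apply/setP=> z; rewrite !inE hE.
Qed.

Lemma homogeneous_partition d N K (e_irr : irreflexive e) :
  contractible d (trigraph_of_graph e_sym e_irr) -> 0 < N ->
  N.+1 * (N.+1 * nbhd_bound d + 2) <= K ->
  exists P : 'I_K -> {set T}, is_partition P /\
    N * \sum_(ij : 'I_K * 'I_K | ~~ homogeneous e (P ij.1) (P ij.2)) #|P ij.1| * #|P ij.2|
      <= 4 * d.+1 * #|T| ^ 2.
Proof.
move=> con N0 leK.
have [f [ff cf bad]] := coarse_labelling con N0.
have [P [part sumE]] := labelled_partition (leq_trans (card_refined_labels con cf) leK).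
exists P; split=> //; rewrite sumE; apply: leq_trans bad.
rewrite leq_mul2l; apply/orP; right; apply: subset_leq_card; apply/subsetP=> -[x y].
rewrite 2!inE in_setX !in_setT /=; apply: contra; exact: good_pair_homogeneous.
Qed.

End Representation.

(** * Choice of the constants and passage to real bounds *)

Theorem theorem7 (R : realType) (t : int) :
  exists c C : R, forall eps : R, 0 < eps ->
  exists K : nat, K%:R <= poly_bound C c eps /\
  forall (T : finType) (e : rel T) (e_sym : symmetric e) (e_irr : irreflexive e),
    ((twin_width e_sym e_irr)%:Z <= t)%R ->
  exists P : 'I_K -> {set T}, is_partition P /\
    \sum_(ij : 'I_K * 'I_K | ~~ homogeneous e (P ij.1) (P ij.2))
        (#|P ij.1| * #|P ij.2|)%:R
      <= eps * #|T|%:R ^+ 2.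
Proof.
(* No graph qualifies when [t] is negative, so the absolute value does no harm. *)
set d := `|t|%N; set D := nbhd_bound d.
(* Chosen so that [N.+1 <= a * M] with M = max(1, 1/eps), the 2 covering the two successors in
   [N.+1]. The exponent is 2 because K is a product of two factors linear in M. *)
set a : R := (4 * d.+1 + 2)%:R.
exists 2%:R, (a * (a * D%:R + 2)) => eps eps0.
set q : R := (4 * d.+1)%:R / eps.
have q0 : 0 <= q by rewrite divr_ge0 // ltW.
(* The successor makes [N] positive and larger than [q], whence 4(d+1)/N <= eps. *)
set N := (Num.truncn q).+1.
exists (N.+1 * (N.+1 * D + 2))%N; split.
  rewrite /poly_bound; set M := Num.max 1 eps^-1.
  have M1 : 1 <= M by rewrite le_max lexx.
  have M0 : 0 <= M by apply: le_trans M1.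
  rewrite powR_mulrn //.
  have leN : N.+1%:R <= a * M.
    rewrite /N -addn2 natrD /a natrD [leRHS]mulrDl; apply: lerD; last by rewrite ler_peMr.
    have /andP[le _] := truncn_itv q0; apply: le_trans le _.
    by rewrite ler_wpM2l // le_max lexx orbT.
  have leN2 : (N.+1 * D + 2)%:R <= (a * D%:R + 2) * M.
    rewrite natrD natrM [leRHS]mulrDl; apply: lerD; last by rewrite ler_peMr.
    by rewrite mulrAC ler_wpM2r.
  rewrite natrM expr2 mulrACA; exact: ler_pM.
move=> T e e_sym e_irr tw.
have : contractible (twin_width e_sym e_irr) (trigraph_of_graph e_sym e_irr).
  by rewrite /twin_width; case: ex_minnP => m /asboolP.
set d0 := twin_width e_sym e_irr in tw *; move=> con.
(* K was fixed before the graph, so the bounds for its twin-width [d0] are enlarged to those for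
   [d]. *)
have le_d : (d0 <= d)%N by rewrite /d; lia.
have leD : (nbhd_bound d0 <= D)%N by rewrite leq_mul // leq_exp2l.
have [|P [part le]] := @homogeneous_partition T e e_sym d0 N (N.+1 * (N.+1 * D + 2)) e_irr
  con isT.
  by rewrite leq_mul2l leq_add2r leq_mul2l leD !orbT.
exists P; split=> //; rewrite -natr_sum; set W := (\sum_(_ | _) _)%N in le *.
have N0 : 0 < N%:R :> R by rewrite ltr0n.
rewrite -(ler_pM2l N0); apply: (@le_trans _ _ ((4 * d.+1)%:R * #|T|%:R ^+ 2)).
  rewrite -natrM -natrX -natrM ler_nat; apply: leq_trans le _.
  by rewrite leq_mul2r leq_mul2l ltnS le_d !orbT.
rewrite [leRHS]mulrA ler_wpM2r ?exprn_ge0 //.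
have /andP[_ /ltW lt] := truncn_itv q0.
by rewrite -ler_pdivrMr.
Qed.
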